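(* Let $d\ge 1$ and let $G$ be a dense subgroup of $(\mathbb{R},+)$. If $S\subset\mathbb{R}^d$ is a $G$-module whose linear span is $\mathbb{R}^d$, then $h(S)\le 2d$.
   Context: Here $S\subset\mathbb{R}^d$ being a $G$-module means that $S$ is an additive subgroup of $\mathbb{R}^d$ such that $gs\in S$ for all $g\in G$ and $s\in S$ (scalar multiplication in $\mathbb{R}^d$). For $S\subseteq\mathbb{R}^d$, the $S$-Helly number $h(S)$ is the smallest positive integer $h$ such that for every $m\in\mathbb{N}$ and all sets $F_1,\dots,F_m$ of the form $F_i=S\cap K_i$ with $K_i\subset\mathbb{R}^d$ convex, the following implication holds: if $F_{i_1}\cap\cdots\cap F_{i_h}\neq\emptyset$ for all $i_1,\dots,i_h\in\{1,\dots,m\}$, then $F_1\cap\cdots\cap F_m\neq\emptyset$. If no such $h$ exists, $h(S):=\infty$. *)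

(* Defs.v *)
From HB Require Import structures.
From mathcomp Require Import all_boot all_order all_algebra.
From mathcomp Require Import all_classical all_reals all_analysis.

Set Implicit Arguments.
Unset Strict Implicit.
Unset Printing Implicit Defensive.

Import Order.TTheory GRing.Theory Num.Theory.
Import numFieldNormedType.Exports.

Local Open Scope classical_set_scope.
Local Open Scope ring_scope.

Definition additive_subgroup (V : zmodType) (A : set V) : Prop :=
  zmod_closed [in A].

Definition Gmodule (R : pzRingType) (V : lmodType R) (G : set R) (S : set V) :
    Prop :=
  additive_subgroup S /\ forall g s, G g -> S s -> S (g *: s).

(* In vector.v, <<X>>%VS is the span of a finite sequence X only. *)
Definition linear_span (R : fieldType) (V : vectType R) (S : set V) : set V :=
  [set v | exists2 X : seq V, [set` X] `<=` S & v \in <<X>>%VS].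

(* [i_] is an arbitrary map: the indices i_1, ..., i_h may repeat.
   For m = 0 the last intersection is the whole space, so that case holds
   trivially. *)
Definition helly_property (R : realType) (d : nat) (S : set 'rV[R]_d)
    (h : nat) : Prop :=
  forall (m : nat) (F : 'I_m -> set 'rV[R]_d),
    (forall i, exists2 K : set 'rV[R]_d,
       @convex_set R 'rV[R]_d K & F i = S `&` K) ->
    (forall i_ : 'I_h -> 'I_m, \bigcap_(k in [set: 'I_h]) F (i_ k) !=set0) ->
    \bigcap_(i in [set: 'I_m]) F i !=set0.

Definition helly_number (R : realType) (d : nat) (S : set 'rV[R]_d) : \bar R :=
  match pselect (exists h, `[< (0 < h)%N /\ helly_property S h >]) with
  | left ex_h => ((ex_minn ex_h)%:R)%:E
  | right _ => +oo%E
  end.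

(* Main.v *)
Require Import Defs.
From HB Require Import structures.
From mathcomp Require Import all_boot all_order all_algebra.
From mathcomp Require Import all_classical all_reals all_analysis.
From mathcomp Require Import ring lra zify.

Set Implicit Arguments.
Unset Strict Implicit.
Unset Printing Implicit Defensive.

Import Order.TTheory GRing.Theory Num.Theory.
Import numFieldNormedType.Exports.

Local Open Scope classical_set_scope.
Local Open Scope ring_scope.

(** The heart of the matter is a statement about finitely many points of S, a
    family (x_j), j in B.  Its core is the intersection of the convex hulls of
    the sets x(B \ i) for i in B.  Once every family of at least 2d + 1 points
    of S is known to have a point of S in its core, the Helly property follows
    as in Radon's proof of Helly's theorem, by induction on the subfamily: if
    all intersections of one set fewer are nonempty, pick a point p_i of S in
    all sets but the i-th; a point of S in the core of (p_i) lies in all sets.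

    To induct on dimension, one proves the sharper statement
    [many_points_core_meets]: the core meets S as soon as
    #|B| >= max(2, 2 r - 1), where r is the linear rank of the homogenized
    points (1, x_j), one more than the dimension of their affine hull.

    Three points or fewer satisfy an affine dependency in which, up to sign,
    only one coefficient is positive; that point is a convex combination of the
    others and so lies in the core.  For four points or more, Stiemke's form of
    the Farkas lemma offers two possibilities.

    - Some point is a strictly positive combination of each x(B \ i).  Then the
      core has nonempty interior relative to the affine hull of the points, and
      S is dense there, because x_0 + sum_j g_j (x_j - x_0) belongs to S for
      all g_j in the dense group G ([positive_system_core_meets]).

    - There are linear forms y_i with sum zero, not all zero on the points,
      such that y_i >= 0 on (1, x_j) for all j != i.  Let J be the set of the i
      with y_i != 0 on the points.  Every point outside J is annihilated by all
      the y_i.  If J is chosen minimal, the y_i with i in J satisfy no linear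
      relation but the multiples of sum_i y_i = 0, hence discarding the points
      of J lowers the rank by at least #|J| - 1 ([rank_on_setD_support]).  As
      #|J| >= 2, the inequality #|B| >= 2 r - 1 survives, and induction applies
      to B \ J, whose core is contained in that of B. *)

(** * The lemmas of Farkas and Stiemke *)

Lemma scalarBZ (R : realFieldType) (V : lmodType R) (f : V -> R) (k : R)
    (y z : V) :
  scalar f -> f (y - k *: z) = f y - k * f z.
Proof. by move=> fs; rewrite addrC -scaleNr fs mulNr addrC. Qed.

Lemma scalarN (R : realFieldType) (V : lmodType R) (f : V -> R) (y : V) :
  scalar f -> f (- y) = - f y.
Proof.
move=> fs; have f0 : f 0 = 0.
  by rewrite -(subrr y) -[X in _ - X]scale1r scalarBZ // mul1r subrr.
by rewrite -[- y]add0r -[y in LHS]scale1r scalarBZ // f0 mul1r sub0r.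
Qed.

(** Bartl's induction on the number of forms.  If dropping the form a_0 makes b
    take a positive value at some z where the other forms are <= 0, then
    a_0 z > 0, and one may shear all forms along a_0 so that they vanish at z
    and use the induction hypothesis for the sheared forms. *)
Lemma farkas (R : realFieldType) (V : lmodType R) (I : eqType) (s : seq I)
    (a : I -> V -> R) (b : V -> R) :
  uniq s -> (forall i, scalar (a i)) -> scalar b ->
  (exists c : I -> R, (forall i, 0 <= c i) /\
     forall y, b y = \sum_(i <- s) c i * a i y) \/
  (exists y, (forall i, i \in s -> a i y <= 0) /\ 0 < b y).
Proof.
elim: s a b => [|i0 s IH] a b.
  move=> _ _ bs; have [[y ypos]|b0] := pselect (exists y, b y != 0).
    right; move: ypos; rewrite neq_lt => /orP[ypos|ypos]; last by exists y.
    by exists (- y); split=> //; rewrite scalarN // oppr_gt0.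
  left; exists (fun=> 0); split=> // y; rewrite big_nil.
  by apply/eqP/negP => /negP ypos; apply: b0; exists y.
rewrite /= => /andP[i0s us] la lb.
have upd c c0 y : \sum_(i <- i0 :: s) (if i == i0 then c0 else c i) * a i y =
    c0 * a i0 y + \sum_(i <- s) c i * a i y.
  rewrite big_cons eqxx; congr (_ + _); apply: eq_big_seq => i si.
  by case: eqP si i0s => // -> ->.
have updP c c0 : (forall i : I, 0 <= c i) -> 0 <= c0 ->
    forall i, 0 <= (if i == i0 then c0 else c i) :> R.
  by move=> cP c0P i; case: ifP.
have [[c [cP cE]]|[z [az bz]]] := IH a b us la lb.
  left; exists (fun i => if i == i0 then 0 else c i); split; first exact: updP.
  by move=> y; rewrite upd mul0r add0r.
have [a0z|a0z] := lerP (a i0 z) 0.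
  right; exists z; split=> // i; rewrite inE => /predU1P[->//|]; exact: az.
have dn0 : a i0 z != 0 by rewrite gt_eqF.
pose sh (f : V -> R) y := f y - f z / a i0 z * a i0 y.
have shs f : scalar f -> scalar (sh f).
  by move=> fs k u v; rewrite /sh fs la; ring.
have shE f y : scalar f -> sh f y = f (y - (a i0 y / a i0 z) *: z).
  by move=> fs; rewrite /sh scalarBZ //; ring.
have [[c [cP cE]]|[y [ay ypos]]] :=
  IH (fun i => sh (a i)) (sh b) us (fun i => shs _ (la i)) (shs _ lb).
  left.
  pose c0 := (b z - \sum_(i <- s) c i * a i z) / a i0 z.
  exists (fun i => if i == i0 then c0 else c i); split.
    apply: updP => //; rewrite /c0 divr_ge0 ?(ltW a0z) // subr_ge0.
    apply: le_trans (ltW bz); rewrite -oppr_ge0 -sumrN big_seq sumr_ge0 // => i.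
    by move=> /az aiz; rewrite oppr_ge0 mulr_ge0_le0.
  move=> y; rewrite upd; have := cE y; rewrite /sh => /eqP.
  rewrite subr_eq => /eqP ->.
  have -> : \sum_(i <- s) c i * (a i y - a i z / a i0 z * a i0 y) =
      \sum_(i <- s) c i * a i y - (\sum_(i <- s) c i * a i z) / a i0 z * a i0 y.
    rewrite !mulr_suml -sumrB; apply: eq_bigr => i _; ring.
  by rewrite /c0; ring.
right; exists (y - (a i0 y / a i0 z) *: z); split; last by rewrite -shE.
move=> i; rewrite inE => /predU1P[->|/ay]; last by rewrite shE.
by rewrite scalarBZ // divfK // subrr.
Qed.

(** If no y as in the second case exists, the Farkas lemma writes each - a_i as
    a nonnegative combination of the forms; adding these relations up, every
    coefficient is at least one. *)
Lemma stiemke (R : realFieldType) (V : lmodType R) (I : finType)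
    (a : I -> V -> R) :
  (forall i, scalar (a i)) ->
  (exists c : I -> R, (forall i, 0 < c i) /\
     forall y, \sum_i c i * a i y = 0) \/
  (exists y, (forall i, 0 <= a i y) /\ exists i, 0 < a i y).
Proof.
move=> la; have [|noy] := pselect (exists y, (forall i, 0 <= a i y) /\
  exists i, 0 < a i y); first by right.
left.
have /choice[c cP] i : exists c : I -> R, (forall j, 0 <= c j) /\
    forall y, - a i y = \sum_j c j * a j y.
  have lN : scalar (fun y => - a i y) by move=> k u v; rewrite la; ring.
  case: (farkas (index_enum_uniq I) la lN) => // -[y [ay aiy]].
  case: noy; exists (- y); split; last by exists i; rewrite scalarN.
  by move=> j; rewrite scalarN // oppr_ge0 ay // mem_index_enum.
exists (fun j => 1 + \sum_i c i j); split.
  by move=> j; rewrite ltr_wpDr // sumr_ge0 // => i _; case: (cP i).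
move=> y.
under eq_bigr => j _ do rewrite mulrDl mul1r mulr_suml.
rewrite big_split /= exchange_big /= -big_split big1 //= => i _.
by rewrite -(cP i).2 subrr.
Qed.

(** * Families of points and their cores *)

(** Homogeneous coordinates: affine relations between the rows of [x] are the
    linear relations between the rows of [homog x]. *)
Definition homog (R : realFieldType) n d (x : 'M[R]_(n, d)) :
    'M[R]_(n, 1 + d) :=
  row_mx (const_mx 1) x.

Definition convex_weights (R : realFieldType) n (B : {set 'I_n})
    (u : 'rV[R]_n) :=
  [/\ forall j, 0 <= u 0 j, forall j, j \notin B -> u 0 j = 0 &
      \sum_j u 0 j = 1].

(** The core of a family is the intersection of the convex hulls of the
    subfamilies with one member left out. *)
Definition core_meets (R : realFieldType) n d (S : set 'rV[R]_d)
    (x : 'M[R]_(n, d)) (B : {set 'I_n}) :=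
  exists2 s, S s &
    forall i, i \in B -> exists2 u, convex_weights (B :\ i) u & s = u *m x.

Lemma mul_homog_eq (R : realFieldType) n d (x : 'M[R]_(n, d)) (u v : 'rV[R]_n) :
  u *m homog x = v *m homog x <->
  \sum_j u 0 j = \sum_j v 0 j /\ u *m x = v *m x.
Proof.
have cE (w : 'rV[R]_n) : w *m const_mx 1 = const_mx (\sum_j w 0 j) :> 'rV_1.
  by apply/rowP => k; rewrite !mxE; apply: eq_bigr => j _; rewrite mxE mulr1.
rewrite /homog !mul_mx_row !cE; split=> [/eq_row_mx[/rowP/(_ 0)]|[-> ->] //].
by rewrite !mxE.
Qed.

Lemma uniform_pos_lower_bound (R : realFieldType) (I : finType) (P : pred I)
    (f : I -> R) :
  (forall i, P i -> 0 < f i) ->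
  exists2 e, 0 < e & forall i, P i -> e <= f i.
Proof.
move=> f0; exists (\big[Num.min/1]_(i | P i) f i).
  exact: lt_bigmin.
by move=> i Pi; apply: bigmin_le_cond.
Qed.

Lemma convex_weightsW (R : realFieldType) n (A B : {set 'I_n}) (u : 'rV[R]_n) :
  A \subset B -> convex_weights A u -> convex_weights B u.
Proof.
move=> /fintype.subsetP AB [u0 uA u1]; split=> // j jB; apply: uA.
by apply: contra jB; exact: AB.
Qed.

(** A point of the core of a nonempty subfamily stays in the hull when any
    member of B is left out: if the member belongs to A this is clear,
    otherwise the hull of all of A is still available. *)
Lemma core_meetsW (R : realFieldType) n d (S : set 'rV[R]_d) (x : 'M[R]_(n, d))
    (A B : {set 'I_n}) :
  (0 < #|A|)%N -> A \subset B -> core_meets S x A -> core_meets S x B.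
Proof.
move=> /card_gt0P[i0 Ai0] AB [s Ss sA]; exists s => // i Bi.
have [Ai|nAi] := boolP (i \in A).
  have [u uw ->] := sA i Ai; exists u => //.
  by apply: convex_weightsW uw; exact: finset.setSD.
have [u uw ->] := sA i0 Ai0; exists u => //; apply: convex_weightsW uw.
apply/fintype.subsetP => j; rewrite !inE => /andP[_ Aj].
by rewrite (fintype.subsetP AB) // andbT; apply: contraNneq nAi => <-.
Qed.

Lemma sum_delta_mx (R : realFieldType) n (k : 'I_n) :
  \sum_j (delta_mx 0 k : 'rV[R]_n) 0 j = 1.
Proof.
rewrite (bigD1 k) //= mxE !eqxx big1 ?addr0 // => j jk.
by rewrite mxE (negPf jk).
Qed.

(** An affine dependency with only one positive coefficient exhibits x_k as a
    convex combination of the other points, while x_k belongs to every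
    other subfamily. *)
Lemma lone_positive_core_meets (R : realFieldType) n d (S : set 'rV[R]_d)
    (x : 'M[R]_(n, d)) (B : {set 'I_n}) (v : 'rV[R]_n) (k : 'I_n) :
  (forall j, j \in B -> S (row j x)) -> k \in B ->
  (forall j, j \notin B -> v 0 j = 0) -> v *m homog x = 0 ->
  0 < v 0 k -> (forall j, j != k -> v 0 j <= 0) ->
  core_meets S x B.
Proof.
move=> xS Bk vB v0 vk vj; exists (row k x); first exact: xS.
move=> i Bi; have [->|ik] := eqVneq i k; last first.
  exists (delta_mx 0 k); last by rewrite rowE.
  split=> [j|j|].
  - by rewrite mxE ler0n.
  - rewrite !inE mxE /=; have [->|//] := eqVneq j k.
    by rewrite eq_sym (negPf ik) Bk.
  - exact: sum_delta_mx.
pose w : 'rV[R]_n := delta_mx 0 k - (v 0 k)^-1 *: v.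
have wk : w *m homog x = delta_mx 0 k *m homog x.
  by rewrite /w mulmxBl -scalemxAl v0 scaler0 subr0.
move/mul_homog_eq: wk => [w1 wx].
exists w; last by rewrite wx rowE.
have wE j : w 0 j = (j == k)%:R - (v 0 k)^-1 * v 0 j by rewrite !mxE eqxx.
have wkk : w 0 k = 0 by rewrite wE eqxx mulVf ?subrr // gt_eqF.
split=> [j|j|].
- have [->|jk] := eqVneq j k; first by rewrite wkk.
  rewrite wE (negPf jk) sub0r oppr_ge0.
  by rewrite mulr_ge0_le0 ?invr_ge0 ?(ltW vk) // vj.
- rewrite !inE negb_and negbK => /orP[/eqP->//|jB].
  rewrite wE (vB j) // mulr0 subr0; case: eqP => // jk.
  by rewrite jk Bk in jB.
- by rewrite w1 sum_delta_mx.
Qed.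

(** * Approximation inside the module *)

Lemma additive_subgroupP (V : zmodType) (S : set V) : additive_subgroup S ->
  [/\ S 0, forall u v, S u -> S v -> S (u - v) &
      forall u v, S u -> S v -> S (u + v)].
Proof.
move=> [S0 SB].
have s0 : S 0 by move: S0; rewrite inE.
have sB u v : S u -> S v -> S (u - v).
  by move=> Su Sv; have := SB u v; rewrite !inE; apply.
split=> // u v Su Sv; rewrite -[v]opprK; apply: (sB _ _ Su).
by rewrite -[- v]sub0r; exact: sB.
Qed.

(** Affine combinations of the points with coefficients in G, except for the
    coefficient at i0 which makes the total 1, can be written as
    x_i0 + sum_j g_j (x_j - x_i0) and so belong to S.  They approximate every
    affine combination. *)
Lemma approx_affine (R : realType) n d (G : set R) (S : set 'rV[R]_d)
    (x : 'M[R]_(n, d)) (B : {set 'I_n}) (c : 'rV[R]_n) (i0 : 'I_n) (e : R) :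
  dense G -> Gmodule G S -> (forall j, j \in B -> S (row j x)) ->
  i0 \in B -> (forall j, j \notin B -> c 0 j = 0) -> \sum_j c 0 j = 1 ->
  0 < e ->
  exists g : 'rV[R]_n, [/\ forall j, j \notin B -> g 0 j = 0,
    \sum_j g 0 j = 1, forall j, `|g 0 j - c 0 j| <= e & S (g *m x)].
Proof.
move=> Gd [/additive_subgroupP[S0 SB SD] GS] xS Bi0 cB c1 e0.
(* The error at [i0] is the sum of the others, hence the factor [n]. *)
have n0 : 0 < n%:R :> R by rewrite ltr0n (leq_ltn_trans _ (ltn_ord i0)).
have /choice[h hP] (j : 'I_n) : exists h, G h /\ `|h - c 0 j| < e / n%:R.
  have [||h []] := Gd (ball (c 0 j) (e / n%:R)).
  - by exists (c 0 j); apply: ballxx; rewrite divr_gt0.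
  - exact: ball_open.
  by move=> hb Gh; exists h; split=> //; rewrite distrC.
pose g : 'rV[R]_n := delta_mx 0 i0 +
  \sum_(j in B :\ i0) h j *: (delta_mx 0 j - delta_mx 0 i0).
have gE j : j != i0 -> g 0 j = if j \in B then h j else 0.
  move=> ji0; rewrite /g mxE summxE mxE (negPf ji0) andbF add0r.
  under eq_bigr => k _ do rewrite !mxE eqxx (negPf ji0) /= subr0.
  have [Bj|nBj] := boolP (j \in B).
    rewrite (bigD1 j) ?inE ?ji0 //= eqxx mulr1 big1 ?addr0 // => k /andP[_ kj].
    by rewrite eq_sym (negPf kj) mulr0.
  apply: big1 => k; rewrite !inE => /andP[_ Bk].
  case: eqP => [jk|]; last by rewrite mulr0.
  by rewrite jk Bk in nBj.
have g1 : \sum_j g 0 j = 1.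
  under eq_bigr do rewrite /g mxE summxE.
  rewrite big_split /= sum_delta_mx exchange_big /= big1 ?addr0 // => k _.
  under eq_bigr => j _ do rewrite mxE [X in _ * X]mxE [X in _ * (_ + X)]mxE.
  by rewrite -mulr_sumr sumrB !sum_delta_mx subrr mulr0.
have gc j : j != i0 -> `|g 0 j - c 0 j| <= e / n%:R.
  move=> ji0; rewrite gE //; case: ifPn => [Bj|nBj]; first exact: ltW (hP j).2.
  by rewrite cB // subrr normr0 divr_ge0 // ltW.
exists g; split=> //.
- move=> j nBj; rewrite gE ?(negPf nBj) //; by apply: contraNneq nBj => ->.
- move=> j; have [->|ji0] := eqVneq j i0; last first.
    apply: le_trans (gc _ ji0) _; rewrite ler_pdivrMr // ler_peMr ?(ltW e0) //.
    by rewrite ler1n (leq_ltn_trans _ (ltn_ord i0)).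
  have -> : g 0 i0 - c 0 i0 = - \sum_(k | k != i0) (g 0 k - c 0 k).
    move: g1 c1; rewrite sumrB (bigD1 i0) //=.
    rewrite [in X in _ -> X -> _](bigD1 i0) //=.
    move=> g1 c1; lra.
  rewrite normrN; apply: le_trans (ler_norm_sum _ _ _) _.
  apply: (@le_trans _ _ (\sum_(k < n) e / n%:R)).
    rewrite [leRHS](bigD1 i0) //= ler_wpDl ?divr_ge0 ?(ltW e0) ?(ltW n0) //.
    by apply: ler_sum => k; exact: gc.
  by rewrite sumr_const card_ord -[leLHS]mulr_natr divfK // gt_eqF.
- rewrite /g mulmxDl -rowE mulmx_suml; apply: (SD); first exact: xS.
  apply: big_ind => // j; rewrite !inE => /andP[_ Bj].
  rewrite -scalemxAl mulmxBl -!rowE; apply: GS; first exact: (hP j).1.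
  by apply: SB; exact: xS.
Qed.

(** Perturb the affine coefficients c of the common point q to g, so that the
    perturbed point lies in S. In the representation l i without x_i this
    introduces the coefficient t = g_i - c_i at x_i; it is removed by a
    multiple of an affine dependency m i with coefficient 1 at x_i, which
    exists because q also has a representation using x_i. The coefficients l i
    were strictly positive, so they stay nonnegative if the perturbation is
    small. *)
Lemma positive_system_core_meets (R : realType) n d (G : set R)
    (S : set 'rV[R]_d) (x : 'M[R]_(n, d)) (B : {set 'I_n})
    (l : 'I_n -> 'rV[R]_n) (q : 'rV[R]_(1 + d)) :
  dense G -> Gmodule G S -> (forall j, j \in B -> S (row j x)) ->
  (1 < #|B|)%N ->
  (forall i j, i \in B -> j \in B :\ i -> 0 < l i 0 j) ->
  (forall i j, i \in B -> j \notin B :\ i -> l i 0 j = 0) ->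
  (forall i, i \in B -> l i *m homog x = q) ->
  core_meets S x B.
Proof.
move=> Gd GS xS B1 lpos l0 lq.
have /card_gt0P[i0 Bi0] : (0 < #|B|)%N by exact: ltnW.
have other i : i \in B -> exists i', i' \in B :\ i.
  by move=> Bi; apply/card_gt0P; have := cardsD1 i B; rewrite Bi; lia.
have lge0 i j : i \in B -> 0 <= l i 0 j.
  move=> Bi; have [jB|jB] := boolP (j \in B :\ i); first exact/ltW/lpos.
  by rewrite l0.
pose s := \sum_j l i0 0 j.
have s0 : 0 < s.
  have [j Bj] := other _ Bi0; rewrite /s (bigD1 j) //= ltr_pwDl //.
    exact: lpos.
  by apply: sumr_ge0 => k _; exact: lge0.
(* The difference of two representations of [q], one of which avoids [x_i]. *)
pose nx i := odflt i [pick i' in B :\ i].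
have nxP i : i \in B -> nx i \in B :\ i.
  move=> /other[i' Bi']; rewrite /nx; case: pickP => [//|/(_ i')].
  by rewrite Bi'.
pose m i := (l (nx i) 0 i)^-1 *: (l (nx i) - l i).
have mii i : i \in B -> m i 0 i = 1.
  move=> Bi; have := nxP i Bi; rewrite !inE => /andP[ni Bni].
  rewrite !mxE (l0 i i Bi) ?inE ?eqxx // subr0 mulVf //.
  by rewrite gt_eqF // lpos // !inE eq_sym ni.
have mB i j : i \in B -> j \notin B -> m i 0 j = 0.
  move=> Bi Bj; have := nxP i Bi; rewrite !inE => /andP[ni Bni].
  have l0j k : k \in B -> l k 0 j = 0.
    by move=> Bk; rewrite l0 // !inE (negPf Bj) andbF.
  by rewrite !mxE !l0j // subrr mulr0.
have mX i : i \in B -> m i *m homog x = 0.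
  move=> Bi; have := nxP i Bi; rewrite !inE => /andP[ni Bni].
  by rewrite -scalemxAl mulmxBl !lq // subrr scaler0.
pose c := s^-1 *: l i0.
have [e e0 eP] : exists2 e, 0 < e & forall p : 'I_n * 'I_n,
    (p.1 \in B) && (p.2 \in B :\ p.1) ->
    e <= s^-1 * l p.1 0 p.2 / (1 + `|m p.1 0 p.2|).
  apply: uniform_pos_lower_bound => -[i j] /= /andP[Bi Bj].
  by rewrite divr_gt0 ?mulr_gt0 ?invr_gt0 ?lpos // ltr_pwDl.
have [||g [gB g1 gc Sg]] :=
    @approx_affine R n d G S x B c i0 e Gd GS xS Bi0 _ _ e0.
- by move=> j Bj; rewrite mxE l0 ?mulr0 // !inE (negPf Bj) andbF.
- under eq_bigr do rewrite mxE.
  by rewrite -mulr_sumr mulVf // gt_eqF.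
exists (g *m x) => // i Bi.
pose t := g 0 i - c 0 i.
(* The perturbed weights, with the coefficient at [x_i] cancelled. *)
pose u := s^-1 *: l i + (g - c) - t *: m i.
have uE j : u 0 j = s^-1 * l i 0 j + (g 0 j - c 0 j) - t * m i 0 j.
  by rewrite !mxE.
have uX : u *m homog x = g *m homog x.
  rewrite mulmxBl mulmxDl mulmxBl -(scalemxAl t) mX // scaler0 subr0.
  by rewrite -!scalemxAl !lq // addrC subrK.
have [u1 ux] := (mul_homog_eq _ _ _).1 uX.
exists u; last by rewrite ux.
have unB j : j \notin B :\ i -> u 0 j = 0.
  rewrite !inE negb_and negbK => /orP[/eqP->|Bj].
    by rewrite uE l0 ?inE ?eqxx // mii // /t; ring.
  rewrite uE mB // gB // mxE !l0 ?inE ?(negPf Bj) ?andbF //; ring.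
split=> //; last by rewrite u1.
move=> j; have [Bj|/unB->//] := boolP (j \in B :\ i).
have := eP (i, j); rewrite /= Bi Bj => /(_ isT).
rewrite ler_pdivlMr ?ltr_pwDl // => eij.
rewrite uE.
have h1 : - e <= g 0 j - c 0 j by have := gc j; rewrite ler_norml => /andP[].
have h2 : t * m i 0 j <= e * `|m i 0 j|.
  apply: le_trans (ler_norm _) _; rewrite normrM ler_wpM2r //; exact: gc.
nra.
Qed.

(** * Separating families and their supports *)

(** The columns of [Y] are linear forms y_i, so that [(X *m Y) j i] is the
    value of y_i on the j-th row of [X]. They witness that the cones spanned by
    the rows B \ i have no common relatively interior point: at such a point
    all y_i would be nonnegative with sum zero, hence zero, although some y_i
    is positive on a row that enters with positive weight. *)
Definition separating_family (R : realFieldType) n N (X : 'M[R]_(n, N))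
    (B : {set 'I_n}) (Y : 'M[R]_(N, n)) :=
  [/\ forall i j, i \notin B -> (X *m Y) j i = 0,
      forall j, j \in B -> \sum_i (X *m Y) j i = 0,
      forall i j, i \in B -> j \in B -> j != i -> 0 <= (X *m Y) j i &
      exists i j, j \in B /\ (X *m Y) j i != 0].

Definition separating_support (R : realFieldType) n N (X : 'M[R]_(n, N))
    (B : {set 'I_n}) (Y : 'M[R]_(N, n)) : {set 'I_n} :=
  [set i | [exists j in B, (X *m Y) j i != 0]]%SET.

(** Stiemke's lemma for the forms Y |-> (y_i - avg) (x_j), j != i, where avg is
    the mean of the y_i.  Subtracting the mean makes the sum of the forms zero;
    dually, a positive relation says that the positive combinations of the
    x(B \ i) obtained for the various i are all equal to their mean. *)
Lemma positive_system_or_separating (R : realFieldType) n N (X : 'M[R]_(n, N))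
    (B : {set 'I_n}) :
  (exists l : 'I_n -> 'rV[R]_n, exists q : 'rV[R]_N,
    [/\ forall i j, i \in B -> j \in B :\ i -> 0 < l i 0 j,
        forall i j, i \in B -> j \notin B :\ i -> l i 0 j = 0 &
        forall i, i \in B -> l i *m X = q]) \/
  (exists Y, separating_family X B Y).
Proof.
(* Right multiplication by [C] subtracts the mean over [B] from the columns. *)
pose C : 'M[R]_n := \matrix_(k, i)
  (((k \in B) && (i \in B))%:R * ((k == i)%:R - #|B|%:R^-1)).
have C1 k : \sum_i C k i = 0.
  under eq_bigr do rewrite mxE.
  have [Bk|Bk] := boolP (k \in B) => /=; last first.
    by rewrite big1 // => i _; rewrite mul0r.
  rewrite (eq_bigr (fun i =>
      (k == i)%:R - (if i \in B then #|B|%:R^-1 else 0))); last first.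
    move=> i _; case: ifPn => [Bi|Bi]; first by rewrite mul1r.
    by rewrite mul0r subr0; case: eqP => // ki; rewrite -ki Bk in Bi.
  rewrite sumrB (bigD1 k) //= eqxx big1 ?addr0; last first.
    by move=> j; rewrite eq_sym => /negPf ->.
  rewrite -big_mkcond sumr_const -[X in 1 - X]mulr_natr mulVf ?subrr //.
  by rewrite pnatr_eq0 -lt0n; apply/card_gt0P; exists k.
pose P (p : 'I_n * 'I_n) := (p.2 \in B) && (p.1 \in B :\ p.2).
pose a (p : 'I_n * 'I_n) (Y : 'M[R]_(N, n)) :=
  (P p)%:R * (X *m Y *m C) p.1 p.2.
have la p : scalar (a p).
  move=> k u v; rewrite /a mulmxDr mulmxDl -scalemxAr -scalemxAl.
  by rewrite mxE [X in _ * (X + _)]mxE; ring.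
case: (stiemke la) => [[c [c0 cE]]|[Y [Y0 [p pY]]]]; last first.
  right; exists (Y *m C); split.
  - move=> i j Bi; rewrite mulmxA mxE big1 // => k _.
    by rewrite [C k i]mxE (negPf Bi) andbF mul0r mulr0.
  - move=> j _; rewrite mulmxA; under eq_bigr do rewrite mxE.
    by rewrite exchange_big big1 //= => k _; rewrite -mulr_sumr C1 mulr0.
  - move=> i j Bi Bj ji; have := Y0 (j, i).
    by rewrite /a /P /= Bi !inE ji Bj mul1r mulmxA.
  - exists p.2, p.1; move: pY; rewrite /a /P mulmxA.
    case: (boolP (p.2 \in B)) => [B2|]; last by rewrite mul0r ltxx.
    rewrite !inE; have [B1|] := boolP (p.1 \in B); last first.
      by rewrite andbF mul0r ltxx.
    case: eqP => _; first by rewrite mul0r ltxx.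
    by rewrite mul1r => /lt0r_neq0.
left.
pose L : 'M[R]_n := \matrix_(i, j) ((P (j, i))%:R * c (j, i)).
(* Evaluate the relation on elementary matrices. *)
have CLX : C *m (L *m X) = 0.
  apply/matrixP => i k; rewrite [RHS]mxE; have := cE (delta_mx k i).
  have aE j l : a (j, l) (delta_mx k i) = (P (j, l))%:R * (X j k * C i l).
    rewrite /a /=; congr (_ * _).
    rewrite mxE (bigD1 i) //= big1 ?addr0; last first.
      move=> i' ii'; rewrite mxE big1 ?mul0r // => k' _.
      by rewrite mxE (negPf ii') andbF mulr0.
    rewrite mxE (bigD1 k) //= big1 ?addr0; last first.
      by move=> k' kk'; rewrite mxE (negPf kk') mulr0.
    by rewrite mxE !eqxx mulr1.
  move=> <-; rewrite mxE.
  rewrite (eq_bigr (fun p => c (p.1, p.2) * a (p.1, p.2) (delta_mx k i)));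
    last by case.
  rewrite -(pair_bigA _ (fun j l => c (j, l) * a (j, l) (delta_mx k i))) /=.
  rewrite exchange_big /=; apply: eq_bigr => l _.
  rewrite [X in _ * X]mxE mulr_sumr; apply: eq_bigr => j _.
  by rewrite aE [L l j]mxE; ring.
pose q : 'rV[R]_N := #|B|%:R^-1 *: \sum_(l in B) row l (L *m X).
exists (fun i => row i L), q; split.
- move=> i j Bi Bj; rewrite !mxE /P /= Bi Bj mul1r; exact: c0.
- by move=> i j Bi /negPf Bj; rewrite !mxE /P /= Bj andbF mul0r.
move=> i Bi; rewrite -row_mul; apply/rowP => k.
move/matrixP: CLX => /(_ i k); rewrite mxE [RHS]mxE.
rewrite (eq_bigr (fun l => (i == l)%:R * (L *m X) l k -
   (if l \in B then #|B|%:R^-1 * (L *m X) l k else 0))); last first.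
  move=> l _; rewrite [C i l]mxE Bi /=; case: ifPn => [Bl|Bl] /=.
    by rewrite mul1r mulrBl.
  rewrite !mul0r; case: eqP => [il|_]; last by rewrite mul0r subrr.
  by rewrite -il Bi in Bl.
rewrite sumrB (bigD1 i) //= eqxx mul1r big1 ?addr0; last first.
  by move=> l; rewrite eq_sym => /negPf ->; rewrite mul0r.
move/eqP; rewrite subr_eq0 => /eqP; rewrite -big_mkcond -mulr_sumr => e.
rewrite mxE e /q mxE summxE; congr (_ * _).
by apply: eq_bigr => l _; rewrite [RHS]mxE.
Qed.

(** Take the support minimal. A relation sum_i c_i y_i = 0 that is not constant
    on the support yields the separating family (c_i - min c) y_i, whose
    support is strictly smaller. *)
Lemma minimal_separating_family (R : realFieldType) n N (X : 'M[R]_(n, N))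
    (B : {set 'I_n}) :
  (exists Y, separating_family X B Y) ->
  exists2 Y, separating_family X B Y &
    forall c : 'I_n -> R,
      (forall j, j \in B -> \sum_i c i * (X *m Y) j i = 0) ->
      {in separating_support X B Y &, forall i i', c i <= c i'}.
Proof.
case=> Y; have [m] := ubnP #|separating_support X B Y|; elim: m Y => // m IH Y.
rewrite ltnS => Ym cY.
have [rel|] := pselect (forall c : 'I_n -> R,
    (forall j, j \in B -> \sum_i c i * (X *m Y) j i = 0) ->
    {in separating_support X B Y &, forall i i', c i <= c i'}).
  by exists Y.
move/existsNP => [c /not_implyP[c0 /existsNP[i1 /existsNP[i2]]]].
move=> /not_implyP[Ji1 /not_implyP[Ji2 /negP]]; rewrite -ltNge => ci.
have [i0 Ji0 ci0] := @arg_minP _ R _ i2 (mem (separating_support X B Y)) c Ji2.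
have {}Ji0 : i0 \in separating_support X B Y by [].
have i0i1 : c i0 < c i1 by apply: le_lt_trans ci; exact: ci0.
pose Y' := Y *m diag_mx (\row_i (c i - c i0)).
have Y'E j i : (X *m Y') j i = (c i - c i0) * (X *m Y) j i.
  rewrite /Y' mulmxA mul_mx_diag mxE [X in _ * X]mxE mulrC //.
have [Y1 Y2 Y3 Y4] := cY.
have offJ i j : j \in B -> i \notin separating_support X B Y ->
    (X *m Y) j i = 0.
  move=> Bj; rewrite inE negb_exists_in => /forall_inP/(_ j Bj).
  by rewrite negbK => /eqP.
have sub : separating_support X B Y' \subset separating_support X B Y :\ i0.
  apply/fintype.subsetP => i; rewrite [in X in X -> _]inE => /exists_inP[j Bj].
  rewrite Y'E mulf_eq0 negb_or subr_eq0 => /andP[ci' Zji].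
  rewrite !inE; apply/andP; split; first by apply: contraNneq ci' => ->.
  by apply/exists_inP; exists j.
apply: (IH Y').
  apply: leq_trans Ym; rewrite (cardsD1 i0 (separating_support X B Y)) Ji0 ltnS.
  exact: subset_leq_card.
split.
- by move=> i j Bi; rewrite Y'E Y1 // mulr0.
- move=> j Bj; under eq_bigr do rewrite Y'E mulrBl.
  by rewrite sumrB c0 // -mulr_sumr Y2 // mulr0 subrr.
- move=> i j Bi Bj ji; rewrite Y'E.
  have [Ji|nJi] := boolP (i \in separating_support X B Y); last first.
    by rewrite offJ // mulr0.
  by rewrite mulr_ge0 ?Y3 // subr_ge0; exact: ci0.
- move: Ji1; rewrite inE => /exists_inP[j Bj Zj]; exists i1, j; split=> //.
  by rewrite Y'E mulf_neq0 // subr_eq0 gt_eqF.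
Qed.

Definition rank_on (R : realFieldType) n N (X : 'M[R]_(n, N))
    (B : {set 'I_n}) :=
  \rank (rowsub (@enum_val _ (mem B)) X).

Lemma row_sub_rowsub_enum (R : realFieldType) n N (X : 'M[R]_(n, N))
    (B : {set 'I_n}) j :
  j \in B -> (row j X <= rowsub (@enum_val _ (mem B)) X)%MS.
Proof.
move=> Bj; have -> : row j X =
    row (enum_rank_in Bj j) (rowsub (@enum_val _ (mem B)) X).
  by rewrite row_rowsub enum_rankK_in.
exact: row_sub.
Qed.

(** The rows outside J lie in the kernel of [Y], and the rank of the rows in B
    modulo this kernel is that of the values of the y_i.  Fixing i0 in J, the
    #|J| - 1 columns of values indexed by J \ i0 are independent: a relation
    between them is a relation c on J with c_i0 = 0, and the last hypothesis,
    being symmetric in i and i', says that such c are constant on J. *)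
Lemma rank_on_setD_support (R : realFieldType) n N (X : 'M[R]_(n, N))
    (B J : {set 'I_n}) (Y : 'M[R]_(N, n)) :
  J \subset B -> (0 < #|J|)%N ->
  (forall i j, j \in B :\: J -> (X *m Y) j i = 0) ->
  (forall c : 'I_n -> R,
      (forall j, j \in B -> \sum_i c i * (X *m Y) j i = 0) ->
      {in J &, forall i i', c i <= c i'}) ->
  (#|J|.-1 + rank_on X (B :\: J) <= rank_on X B)%N.
Proof.
move=> JB /card_gt0P[i0 Ji0] Z0 rel.
rewrite /rank_on; set XB := rowsub (@enum_val _ (mem B)) X.
rewrite -[leqRHS](mxrank_mul_ker XB Y); apply: leq_add; last first.
  apply: mxrankS; rewrite sub_capmx; apply/andP; split.
    apply/row_subP => t; rewrite row_rowsub; apply: row_sub_rowsub_enum.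
    by have := enum_valP t; rewrite inE => /andP[].
  apply/sub_kermxP; rewrite mul_rowsub_mx; apply/matrixP => t i.
  by rewrite mxE Z0 ?mxE //; exact: enum_valP.
pose J' := J :\ i0.
have -> : #|J|.-1 = #|J'| by rewrite (cardsD1 i0 J) Ji0.
(* [v *m E] extends [v] by zero from [J'] to all indices. *)
pose E : 'M[R]_(#|J'|, n) := \matrix_(t, i) (enum_val t == i)%:R.
rewrite -[X in (_ <= X)%N]mxrank_tr.
suff /eqP <- : row_free (E *m (XB *m Y)^T) by exact: mxrankM_maxr.
apply: inj_row_free => v; rewrite mulmxA => vE0.
pose c i := (v *m E) 0 i.
have cJ t : c (enum_val t) = v 0 t.
  rewrite /c mxE (bigD1 t) //= mxE eqxx mulr1 big1 ?addr0 // => s st.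
  by rewrite mxE (inj_eq enum_val_inj) (negPf st) mulr0.
have ci0 : c i0 = 0.
  rewrite /c mxE big1 // => t _; rewrite mxE; case: eqP => [ti0|]; last first.
    by rewrite mulr0.
  by have := enum_valP t; rewrite ti0 !inE eqxx.
have crel j : j \in B -> \sum_i c i * (X *m Y) j i = 0.
  move=> Bj; move/rowP: vE0 => /(_ (enum_rank_in Bj j)).
  rewrite [LHS]mxE [RHS]mxE => vj; rewrite -[RHS]vj; apply: eq_bigr => i _.
  by congr (_ * _); rewrite [RHS]mxE mul_rowsub_mx [RHS]mxE enum_rankK_in.
apply/rowP => t; rewrite mxE -cJ.
have Jt : enum_val t \in J by have := enum_valP t; rewrite !inE => /andP[].
by apply/eqP; rewrite eq_le -[0]ci0 !(rel _ crel).
Qed.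

(** The points are affinely dependent, and of at most three coefficients either
    at most one is positive or at most one is negative. *)
Lemma few_points_core_meets (R : realFieldType) n d (S : set 'rV[R]_d)
    (x : 'M[R]_(n, d)) (B : {set 'I_n}) :
  (forall j, j \in B -> S (row j x)) ->
  (#|B| <= 3)%N -> (rank_on (homog x) B < #|B|)%N -> core_meets S x B.
Proof.
move=> xS B3 rB.
have [v [vB v0 vX]] : exists v : 'rV[R]_n,
    [/\ forall j, j \notin B -> v 0 j = 0, v != 0 & v *m homog x = 0].
  have : kermx (rowsub (@enum_val _ (mem B)) (homog x)) != 0.
    by rewrite kermx_eq0 -row_leq_rank -ltnNge.
  move=> /rowV0Pn[w /sub_kermxP wX w0].
  pose E : 'M[R]_(#|B|, n) := \matrix_(t, i) (enum_val t == i)%:R.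
  have cE t : (w *m E) 0 (enum_val t) = w 0 t.
    rewrite mxE (bigD1 t) //= mxE eqxx mulr1 big1 ?addr0 // => s st.
    by rewrite mxE (inj_eq enum_val_inj) (negPf st) mulr0.
  exists (w *m E); split.
  - move=> j Bj; rewrite mxE big1 // => t _; rewrite mxE; case: eqP => [tj|].
      by rewrite -tj enum_valP in Bj.
    by rewrite mulr0.
  - apply: contra_neq w0 => wE; apply/rowP => t.
    by rewrite -cE wE !mxE.
  - rewrite -mulmxA -[RHS]wX; congr (_ *m _); apply/matrixP => t k.
    rewrite [RHS]mxE mxE (bigD1 (enum_val t)) //= mxE eqxx mul1r big1 ?addr0 //.
    by move=> j jt; rewrite mxE eq_sym (negPf jt) mul0r.
pose pos (u : 'rV[R]_n) := [set j | 0 < u 0 j]%SET.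
wlog pos1 : v vB v0 vX / (#|pos v| <= 1)%N => [wl|].
  have [|n1] := leqP #|pos v| 1; first exact: wl.
  apply: (wl (- v)); rewrite ?oppr_eq0 ?mulNmx ?vX ?oppr0 //.
    by move=> j Bj; rewrite mxE vB ?oppr0.
  have dis : #|pos v :&: pos (- v)| = 0%N.
    by apply: eq_card0 => j; rewrite !inE mxE oppr_gt0; case: ltgtP.
  have : (#|pos v :|: pos (- v)| <= 3)%N.
    apply: leq_trans B3; apply: subset_leq_card; apply/fintype.subsetP => j.
    rewrite !inE mxE; apply: contraTT => /vB ->.
    by rewrite oppr0 ltxx.
  by rewrite cardsU dis; lia.
have vsum : \sum_j v 0 j = 0.
  have [+ _] := (mul_homog_eq x v 0).1 (etrans vX (esym (mul0mx _ _))).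
  by move=> ->; rewrite big1 // => j _; rewrite mxE.
have [k vk] : exists k, 0 < v 0 k.
  apply: contrapT => /forallNP np; move/negP: v0; apply.
  have vle j : 0 <= - v 0 j by rewrite oppr_ge0 leNgt; apply/negP/np.
  apply/eqP/rowP => j; rewrite mxE; apply: oppr_inj; rewrite oppr0.
  move: vsum => /(congr1 -%R); rewrite oppr0 -sumrN => /eqP.
  by rewrite psumr_eq0 // => /allP/(_ j (mem_index_enum _))/eqP.
apply: (@lone_positive_core_meets _ _ _ S x B v k) => //.
  by apply: contraTT vk => /vB ->; rewrite ltxx.
move=> j jk; rewrite leNgt; apply/negP => vj.
move: pos1; rewrite leqNgt => /negP; apply.
apply/card_gt1P; exists j, k; split=> //; by rewrite inE.
Qed.

(** For j outside the support y_j vanishes on x_j, so the values of all the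
    forms at x_j are nonnegative with sum zero. The support has two elements at
    least because a single nonzero value in a row could not sum to zero. *)
Lemma separating_supportP (R : realFieldType) n N (X : 'M[R]_(n, N))
    (B : {set 'I_n}) (Y : 'M[R]_(N, n)) :
  separating_family X B Y ->
  [/\ separating_support X B Y \subset B, (1 < #|separating_support X B Y|)%N &
      forall i j, j \in B :\: separating_support X B Y -> (X *m Y) j i = 0].
Proof.
case=> Y1 Y2 Y3 [i1 [j1 [Bj1 Z1]]]; split.
- apply/fintype.subsetP => i; rewrite inE => /exists_inP[j Bj].
  by apply: contraNT => /Y1 ->.
- have Ji1 : i1 \in separating_support X B Y.
    by rewrite inE; apply/exists_inP; exists j1.
  rewrite ltnNge; apply: contra Z1 => J1.
  rewrite -(Y2 _ Bj1) (bigD1 i1) //= big1 ?addr0 // => i ii1.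
  apply/eqP; apply: contraLR J1 => Zi; rewrite -ltnNge.
  apply/card_gt1P; exists i, i1; split=> //.
  by rewrite inE; apply/exists_inP; exists j1.
move=> i j; rewrite finset.in_setD => /andP[nJj Bj].
have Zjj : (X *m Y) j j = 0.
  by apply: contraNeq nJj => Zjj; rewrite inE; apply/exists_inP; exists j.
have Zge0 k : 0 <= (X *m Y) j k.
  have [Bk|/Y1->//] := boolP (k \in B).
  have [<-|jk] := eqVneq j k; first by rewrite Zjj.
  exact: Y3.
move/eqP: (Y2 j Bj); rewrite psumr_eq0 // => /allP/(_ i (mem_index_enum _)).
by move/eqP.
Qed.

(** * The core of a large family *)

(** The bound is self-reproducing: removing a minimal support J, of size at
    least two, costs #|J| points but lowers twice the rank by at least
    2 #|J| - 2. *)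
Lemma many_points_core_meets (R : realType) n d (G : set R) (S : set 'rV[R]_d)
    (x : 'M[R]_(n, d)) (B : {set 'I_n}) :
  dense G -> Gmodule G S -> (forall j, j \in B -> S (row j x)) ->
  (1 < #|B|)%N -> (2 * rank_on (homog x) B <= #|B|.+1)%N -> core_meets S x B.
Proof.
move=> Gd GS; have [m] := ubnP #|B|; elim: m B => // m IH B.
rewrite ltnS => Bm xS B1 rB.
(* With at most three points the hypotheses force the rank below [#|B|]. *)
have [B3|B4] := leqP #|B| 3; first by apply: few_points_core_meets => //; lia.
case: (positive_system_or_separating (homog x) B) => [[l [q [l1 l2 l3]]]|].
  exact: (positive_system_core_meets Gd GS xS B1 l1 l2 l3).
move=> /minimal_separating_family[Y cY rel].
have [JB J2 Z0] := separating_supportP cY.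
have := rank_on_setD_support JB (ltnW J2) Z0 rel.
have := cardsD B (separating_support (homog x) B Y).
rewrite (finset.setIidPr JB).
have := subset_leq_card JB.
set J := separating_support _ _ _ in JB J2 *; move=> cJB cBJ rJ.
(* A remaining point is a nonzero vector of homogeneous coordinates; this
   excludes that only one point remains. *)
have rpos : (0 < #|B :\: J|)%N -> (0 < rank_on (homog x) (B :\: J))%N.
  case/card_gt0P => j /(row_sub_rowsub_enum (homog x))/mxrankS.
  rewrite -/(rank_on _ _).
  apply: leq_trans; rewrite lt0n mxrank_eq0; apply/eqP => /rowP/(_ 0).
  have -> : (0 : 'I_(1 + d)) = lshift d 0 by apply/val_inj.
  by move/eqP; rewrite mxE row_mxEl !mxE oner_eq0.
have BJ2 : (1 < #|B :\: J|)%N.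
  have [z|/rpos] := posnP #|B :\: J|; lia.
apply: (@core_meetsW _ _ _ _ _ (B :\: J)); [lia|exact: finset.subsetDl|].
apply: IH => //; [lia| |lia].
by move=> j; rewrite finset.in_setD => /andP[_]; exact: xS.
Qed.

(** * From cores to the Helly property *)

Lemma convex_set_sum (R : realFieldType) (V : lmodType R) (K : set V)
    (I : eqType) (r : seq I) (u : I -> R) (p : I -> V) :
  @convex_set R V K -> (forall i, i \in r -> 0 <= u i) ->
  (forall i, i \in r -> u i != 0 -> K (p i)) -> \sum_(i <- r) u i = 1 ->
  K (\sum_(i <- r) u i *: p i).
Proof.
move=> cK.
(* Peel off one point and rescale the weights of the others to sum to one. *)
elim: r u => [|i r IH] u u0 Kp.
  by rewrite big_nil => /eqP; rewrite eq_sym oner_eq0.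
rewrite !big_cons => u1.
have ui0 : 0 <= u i by apply: u0; rewrite mem_head.
have ur0 k : k \in r -> 0 <= u k by move=> rk; apply: u0; rewrite inE rk orbT.
have sr0 : 0 <= \sum_(k <- r) u k by rewrite big_seq sumr_ge0.
have [uiz|uin0] := eqVneq (u i) 0.
  rewrite uiz scale0r add0r; apply: IH => //.
    by move=> k rk; apply: Kp; rewrite inE rk orbT.
  by rewrite -u1 uiz add0r.
have Kpi : K (p i) by apply: Kp => //; rewrite mem_head.
have [sz|sn0] := eqVneq (\sum_(k <- r) u k) 0.
  have ui1 : u i = 1 by rewrite -u1 sz addr0.
  rewrite ui1 scale1r big1_seq ?addr0 // => k /= rk.
  move/eqP: sz; rewrite big_seq psumr_eq0; last by move=> l; exact: ur0.
  by move=> /allP/(_ k rk); rewrite rk => /eqP ->; rewrite scale0r.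
set s := \sum_(k <- r) u k in u1 sr0 sn0.
have s0 : 0 < s by rewrite lt_neqAle eq_sym sn0.
have Kq : K (\sum_(k <- r) (s^-1 * u k) *: p k).
  apply: IH.
  - by move=> k rk; rewrite mulr_ge0 ?invr_ge0 ?ur0.
  - move=> k rk; rewrite mulf_eq0 negb_or => /andP[_ uk].
    by apply: Kp => //; rewrite inE rk orbT.
  - by rewrite -mulr_sumr mulVf.
have ui1 : u i <= 1 by rewrite -u1 lerDl.
have t01 : Itv.spec (@Itv.num_sem R) (Itv.Real `[0%Z, 1%Z]) (u i).
  by rewrite /= /Itv.num_sem num_real /= in_itv /= ui0 ui1.
have := cK (p i) _ (Itv.mk t01) (mem_set Kpi) (mem_set Kq).
rewrite inE /conv /=.
have -> : \sum_(k <- r) u k *: p k =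
    (1 - u i) *: \sum_(k <- r) (s^-1 * u k) *: p k.
  rewrite -u1 addrC addKr scaler_sumr; apply: eq_bigr => k _.
  by rewrite scalerA mulrA mulfV // mul1r.
by [].
Qed.

(** Given points p_i of S that lie in all sets of the subfamily B but the i-th,
    the core of (p_i) meets S; such a point lies in the hull of points of F_i
    for every i in B. *)
Lemma Gmodule_helly_property (R : realType) (d : nat) (G : set R)
    (S : set 'rV[R]_d) :
  (0 < d)%N -> dense G -> Gmodule G S -> helly_property S (2 * d).
Proof.
move=> d0 Gd GS m F FK F2d.
have S0 : S 0 by case: GS => /additive_subgroupP[].
suff all_sub (B : {set 'I_m}) : exists2 s, S s & forall i, i \in B -> F i s.
  have [s _ sF] := all_sub [set: 'I_m]%SET.
  by exists s => i _; apply: sF; rewrite inE.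
have [k] := ubnP #|B|; elim: k B => // k IH B; rewrite ltnS => Bk.
have [B2d|B2d] := leqP #|B| (2 * d).
  have [/eqP|/card_gt0P[i0 Bi0]] := posnP #|B|.
    by rewrite cards_eq0 => /eqP ->; exists 0 => // i; rewrite inE.
  have [s sF] := F2d (fun t => nth i0 (enum B) t).
  have sB i : i \in B -> F i s.
    move=> Bi.
    have it : (index i (enum B) < 2 * d)%N.
      by apply: leq_trans B2d; rewrite cardE index_mem mem_enum.
    by have := sF (Ordinal it) I; rewrite /= nth_index // mem_enum.
  exists s => //; have [K _ FE] := FK i0.
  by have := sB _ Bi0; rewrite FE => -[].
have /choice[p pP] (i : 'I_m) : exists p, S p /\
    (i \in B -> forall j, j \in B :\ i -> F j p).
  have [Bi|nBi] := boolP (i \in B); last by exists 0.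
  have [|p Sp pF] := IH (B :\ i); last by exists p.
  by apply: leq_trans Bk; rewrite (cardsD1 i B) Bi.
pose x := \matrix_i p i.
have [|||s Ss sP] := @many_points_core_meets R m d G S x B Gd GS.
- by move=> j _; rewrite rowK; exact: (pP j).1.
- lia.
- have := rank_leq_col (rowsub (@enum_val _ (mem B)) (homog x)).
  by rewrite /rank_on; lia.
exists s => // i Bi; have [u [u0 uB u1] su] := sP i Bi.
have [K cK FE] := FK i; rewrite FE; split=> //.
rewrite su mulmx_sum_row; apply: convex_set_sum => // j _ uj.
have : j \in B :\ i by apply: contraNT uj => /uB ->.
rewrite !inE rowK => /andP[ji Bj].
have : F i (p j) by apply: (pP j).2; rewrite // !inE eq_sym ji.
by rewrite FE => -[].
Qed.

Theorem theorem1p3 (R : realType) (d : nat) (hd : (1 <= d)%N)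
    (G : set R) (hG : additive_subgroup G) (Gdense : dense G)
    (S : set 'rV[R]_d) (hS : Gmodule G S)
    (Sspan : linear_span S = [set: 'rV[R]_d]) :
  (helly_number S <= ((2 * d)%:R)%:E)%E.
Proof.
have h2d : `[< (0 < 2 * d)%N /\ helly_property S (2 * d) >].
  by apply/asboolP; split; [lia|exact: Gmodule_helly_property hd Gdense hS].
rewrite /helly_number; case: pselect => [ex_h|[]]; last by exists (2 * d)%N.
by case: ex_minnP => h _ /(_ _ h2d) hle; rewrite lee_fin ler_nat.
Qed.
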